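(* For any natural number $t$, there is a positive integer $n$ such that $1\in\widehat{\mathbf{MG}}_n^{(t)}$.
   Context: Mordell constant: a symmetric box in $\mathbb{R}^n$ is a set $[-a_1,a_1]\times\cdots\times[-a_n,a_n]$ with $a_i>0$; it is admissible for a lattice $\Lambda\subset\mathbb{R}^n$ if its interior contains no nonzero point of $\Lambda$. Then $\kappa(\Lambda)=\sup_{\mathcal{B}}\frac{\mathrm{Vol}(\mathcal{B})}{2^n\mathrm{Vol}(\Lambda)}$, the supremum over symmetric boxes $\mathcal{B}$ admissible for $\Lambda$, where $\mathrm{Vol}(\Lambda)$ is the covolume. A lattice $\Lambda\subset\mathbb{R}^n$ is decomposable if there are $n_1,n_2>0$ with $n=n_1+n_2$ and a partition of the coordinates into subsets of sizes $n_1,n_2$, with corresponding direct sum decomposition $\mathbb{R}^n=\mathbb{R}^{n_1}\oplus\mathbb{R}^{n_2}$, such that $\Lambda=\Lambda_1\oplus\Lambda_2$ where $\Lambda_i=\Lambda\cap\mathbb{R}^{n_i}$. The reduced Mordell-Gruber spectrum is $\widehat{\mathbf{MG}}_n=\{\kappa(\Lambda):\Lambda\subset\mathbb{R}^n\text{ a lattice which is not decomposable}\}\subset\mathbb{R}$. For a set $S\subset\mathbb{R}$, put $S^{(0)}=S$ and let $S^{(k+1)}$ be the set of elements of $S^{(k)}$ which are limits of strictly increasing sequences in $S^{(k)}$. *)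

(* Defs.v *)
From HB Require Import structures.
From mathcomp Require Import all_boot all_order all_algebra.
From mathcomp Require Import all_classical all_reals all_analysis.

Set Implicit Arguments.
Unset Strict Implicit.
Unset Printing Implicit Defensive.
Import Order.TTheory GRing.Theory Num.Theory.
Import numFieldNormedType.Exports.

Local Open Scope classical_set_scope.
Local Open Scope ring_scope.

(* The lattice whose basis is the family of rows of [B]. *)
Definition int_span (R : realType) (n : nat) (B : 'M[R]_n) : set 'rV[R]_n :=
  [set map_mx intr c *m B | c in [set: 'rV[int]_n]].

Definition lattice_basis (R : realType) (n : nat) (L : set 'rV[R]_n)
    (B : 'M[R]_n) : Prop :=
  B \in unitmx /\ L = int_span B.

Definition is_lattice (R : realType) (n : nat) (L : set 'rV[R]_n) : Prop :=
  exists B : 'M[R]_n, lattice_basis L B.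

(* [get] picks an arbitrary basis; by [covolE] the choice is immaterial. *)
Definition covol (R : realType) (n : nat) (L : set 'rV[R]_n) : R :=
  `|\det (get (lattice_basis L))|.

Lemma covolE (R : realType) (n : nat) (L : set 'rV[R]_n) (B : 'M[R]_n) :
  lattice_basis L B -> covol L = `|\det B|.
Proof.
suff key (C D : 'M[R]_n) : lattice_basis L C -> lattice_basis L D ->
    exists u : int, \det C = u%:~R * \det D.
  move=> hB; have hG : lattice_basis L (get (lattice_basis L)).
    exact: (getI hB).
  rewrite /covol; move: (get _) hG => G hG.
  have [u hu] := key _ _ hG hB; have [v hv] := key _ _ hB hG.
  have dB : \det B != 0 by case: hB; rewrite unitmxE unitfE.
  have : (v * u)%:~R = 1 :> R.
    by apply: (mulIf dB); rewrite mul1r intrM -mulrA -hu -hv.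
  move=> /eqP; rewrite -[1]/(1%:~R) eqr_int => /eqP vu.
  have u1 : `|u| = 1.
    apply/eqP; move: (congr1 (fun z : int => absz z) vu).
    rewrite abszM /= => /eqP; rewrite muln_eq1 => /andP[_ /eqP h].
    by rewrite -abszE h.
  by rewrite hu normrM -intr_norm u1 mul1r.
move=> [_ LC] [_ LD].
have rowP (i : 'I_n) : exists c : 'rV[int]_n, map_mx intr c *m D = row i C.
  have : L (row i C).
    rewrite LC; exists (delta_mx 0 i) => //.
    by rewrite map_delta_mx -rowE.
  by rewrite LD => -[c _ hc]; exists c.
have [c hc] := choice rowP.
exists (\det (\matrix_i c i)).
rewrite -det_map_mx -det_mulmx; congr (\det _).
apply/row_matrixP => i; rewrite row_mul -map_row rowK.
by rewrite hc.
Qed.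

Definition box (R : realType) (n : nat) (a : 'rV[R]_n) : set 'rV[R]_n :=
  [set x : 'rV[R]_n | forall i, x ord0 i \in `[- a ord0 i, a ord0 i]].

Definition box_vol (R : realType) (n : nat) (a : 'rV[R]_n) : R :=
  \prod_(i < n) (2 * a ord0 i).

Definition admissible (R : realType) (n : nat) (L A : set 'rV[R]_n) : Prop :=
  forall x, L x -> interior A x -> x = 0.

(* When [L] is a lattice the set below is nonempty, and bounded above by 1 by
   Minkowski's convex body theorem, so the real-valued [sup] is the supremum. *)
Definition kappa (R : realType) (n : nat) (L : set 'rV[R]_n) : R :=
  sup [set box_vol a / (2 ^+ n * covol L) |
        a in [set a : 'rV[R]_n | (forall i, 0 < a ord0 i) /\ admissible L (box a)]].

Definition coord_subspace (R : realType) (n : nat) (I : {set 'I_n}) :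
    set 'rV[R]_n :=
  [set x : 'rV[R]_n | forall i, i \notin I -> x ord0 i = 0].

(* The sum is automatically direct: the coordinate subspaces of [I] and of its
   complement meet only in 0. *)
Definition decomposable (R : realType) (n : nat) (L : set 'rV[R]_n) : Prop :=
  exists I : {set 'I_n}, [/\ (0 < #|I|)%N, (0 < #|~: I|)%N &
    L = [set x + y | x in L `&` coord_subspace I
                   & y in L `&` coord_subspace (~: I)]].

Definition reduced_MG (R : realType) (n : nat) : set R :=
  [set kappa L | L in [set L : set 'rV[R]_n | is_lattice L /\ ~ decomposable L]].

Arguments reduced_MG R n : clear implicits.

Definition left_derived (R : realType) (S : set R) : set R :=
  [set x | S x /\ exists u : R^nat,
     [/\ forall k, S (u k), increasing_seq u & u @ \oo --> x]].

Definition iter_left_derived (R : realType) (k : nat) (S : set R) : set R :=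
  iter k (@left_derived R) S.

(* Main.v *)
(* Let M be a lattice with a surjective character chi : M -> Z/2, K = ker chi.
   Gluing (M, chi) to (M', chi') along chi + chi' = 0 makes kappa
   multiplicative: if two boxes contain nonzero points x, x' of M, M' that are
   not in the kernels, then (x, x') is in the glued lattice, so all but one of
   the factors of an admissible box are admissible for the large lattice, and
   the last one for the kernel.  The blocks are Z with 2Z, for which kappa = 1,
   and the quadratic lattices M = Z + Z alpha with
   alpha = b + sqrt(b^2 + 2) and character (x + y alpha) |-> x mod 2: the kernel
   is alpha M, so M and K have the same Mordell constant alpha / (alpha + h),
   h = 2 / alpha, which increases strictly to 1 with b.  In dimension 1 + 2t the
   reduced spectrum thus contains all products of at most t of these numbers,
   and a product of s of them survives t - s derivations. *)

Require Import Defs.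
From mathcomp Require Import all_boot all_order all_algebra.
From mathcomp Require Import all_classical all_reals all_analysis.
From mathcomp Require Import zify ring lra.

Set Implicit Arguments.
Unset Strict Implicit.
Unset Printing Implicit Defensive.
Import Order.TTheory GRing.Theory Num.Theory.
Import numFieldNormedType.Exports.

Local Open Scope classical_set_scope.
Local Open Scope ring_scope.

(** * The interior of a box *)

Lemma interior_box (R : realType) (n : nat) (a x : 'rV[R]_n) :
  interior (box a) x <-> forall i, `|x 0 i| < a 0 i.
Proof.
have e0 : (ord0 : 'I_1) = 0 by exact: val_inj.
rewrite /box e0; split=> [|xa].
  move=> /nbhs_ballP[e /= e_gt0 xe] i; rewrite ltNge; apply/negP => ax.
  (* Every coordinate moves away from 0 by [e / 2], which stays in the ball but leaves the box at
     [i] as soon as [a 0 i <= |x 0 i|]. *)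
  pose y := \row_j (x 0 j + if 0 <= x 0 j then e / 2 else - (e / 2)).
  have /xe /(_ i) : ball x e y.
    split=> // k j; rewrite (ord1 k) mxE /ball /= opprD addrA subrr sub0r normrN.
    by rewrite fun_if normrN if_same gtr0_norm; lra.
  by rewrite mxE in_itv /= => /andP[]; case: (ger0P (x 0 i)) ax => x0; lra.
have cvx i : \forall y \near x, (y : 'rV[R]_n) 0 i \in `[- a 0 i, a 0 i].
  have /= := @coord_continuous R 1 n 0 i x.
  move=> /cvgr_dist_lt /(_ (a 0 i - `|x 0 i|)).
  rewrite subr_gt0 => /(_ (xa i)); apply: filterS => y /= h.
  rewrite in_itv /=; move: h (xa i); rewrite !ltr_norml.
  by case: (ger0P (x 0 i)); move=> ? /andP[? ?] /andP[? ?]; apply/andP; split; lra.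
exact: filter_forall cvx.
Qed.

(** * Lattices with a character to Z/2, and their sums *)

Section MarkedLattice.
Variable R : realType.

Definition pt (n : nat) (B : 'M[R]_n) (c : 'rV[int]_n) : 'rV[R]_n :=
  map_mx intr c *m B.

(** Kernel of the character, in coordinates. The column [X] has integer entries, not residues mod 2,
    so that it can serve as a block of a lattice basis. *)
Definition even (n : nat) (X : 'cV[int]_n) (c : 'rV[int]_n) : bool :=
  (2 %| ((c *m X) 0 0)%R)%Z.

Definition in_box (n : nat) (a x : 'rV[R]_n) : Prop := forall i, `|x 0 i| < a 0 i.

(** Coordinates are selected by a predicate, so that passing to a block is composition with [lshift]
    or [rshift]. *)
Definition restr (n : nat) (J : pred 'I_n) (x : 'rV[R]_n) : 'rV[R]_n :=
  \row_i (if J i then x 0 i else 0).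

Definition free_box (n : nat) (B : 'M[R]_n) (a : 'rV[R]_n) : Prop :=
  forall c, in_box a (pt B c) -> c = 0.

(** Admissibility for the kernel of the character. The kernel has index 2 once [X] has an odd entry,
    whence the factor 2 in [good_even_free]. *)
Definition even_free_box (n : nat) (B : 'M[R]_n) X (a : 'rV[R]_n) : Prop :=
  forall c, even X c -> in_box a (pt B c) -> c = 0.

(* [good_linked] gives indecomposability: if the lattice is glued to a vector
   outside the coordinates of [B], then in a splitting of the coordinates [l]
   must lie on the same side as that vector. *)
Record good (n : nat) (B : 'M[R]_n) (X : 'cV[int]_n) (q : R) : Prop := Good {
  good_unit : B \in unitmx;
  good_ge0 : 0 <= q;
  good_free : forall a : 'rV[R]_n, (forall i, 0 < a 0 i) -> free_box B a ->
    \prod_i a 0 i <= q * `|\det B|;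
  good_even_free : forall a : 'rV[R]_n, (forall i, 0 < a 0 i) -> even_free_box B X a ->
    \prod_i a 0 i <= 2 * q * `|\det B|;
  good_attained : exists a : 'rV[R]_n, [/\ forall i, 0 < a 0 i, free_box B a &
    \prod_i a 0 i = q * `|\det B|];
  good_linked : forall l, exists2 c : 'rV[int]_n, ~~ even X c &
    forall J c', ~~ J l -> pt B c' = restr J (pt B c) -> even X c' }.

Lemma pt_row m n (A : 'M[R]_m) (B : 'M[R]_n) c d :
  pt (block_mx A 0 0 B) (row_mx c d) = row_mx (pt A c) (pt B d).
Proof. by rewrite /pt map_row_mx mul_row_block !mulmx0 addr0 add0r. Qed.

Lemma pt0 n (B : 'M[R]_n) : pt B 0 = 0.
Proof. by rewrite /pt map_mx0 mul0mx. Qed.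

Lemma pt_inj n (B : 'M[R]_n) : B \in unitmx -> injective (pt B).
Proof.
move=> uB c d /(congr1 (mulmx^~ (invmx B))); rewrite /pt !mulmxK//.
move=> /matrixP h; apply/matrixP => i j; move: (h i j); rewrite !mxE.
exact: intr_inj.
Qed.

Lemma even0 n (X : 'cV[int]_n) : even X 0.
Proof. by rewrite /even mul0mx mxE dvdz0. Qed.

Lemma even_row m n (X : 'cV[int]_m) (Y : 'cV[int]_n) c d :
  even (col_mx X Y) (row_mx c d) = (even X c == even Y d).
Proof.
rewrite /even mul_row_col mxE.
by set u := fun_of_matrix _ _ _; set v := fun_of_matrix _ _ _; lia.
Qed.

Lemma in_box_row m n (a x : 'rV[R]_m) (b y : 'rV[R]_n) :
  in_box (row_mx a b) (row_mx x y) <-> in_box a x /\ in_box b y.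
Proof.
split=> [h|[ha hb] i].
  by split=> i; [have := h (lshift n i)|have := h (rshift m i)];
    rewrite ?row_mxEl ?row_mxEr.
by rewrite -(splitK i); case: (fintype.split i) => j /=; rewrite ?row_mxEl ?row_mxEr.
Qed.

Lemma in_box0 n (a : 'rV[R]_n) : (forall i, 0 < a 0 i) -> in_box a 0.
Proof. by move=> h i; rewrite mxE normr0. Qed.

Lemma prod_row m n (a : 'rV[R]_m) (b : 'rV[R]_n) :
  \prod_i (row_mx a b) 0 i = (\prod_i a 0 i) * \prod_i b 0 i.
Proof.
rewrite big_split_ord /=; congr (_ * _); apply: eq_bigr => i _;
by rewrite ?row_mxEl ?row_mxEr.
Qed.

Lemma restr_row m n (J : pred 'I_(m + n)) (x : 'rV[R]_m) (y : 'rV[R]_n) :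
  restr J (row_mx x y) =
  row_mx (restr (J \o @lshift m n) x) (restr (J \o @rshift m n) y).
Proof.
apply/rowP => i; rewrite -(splitK i); case: (fintype.split i) => j /=;
by rewrite [LHS]mxE ?row_mxEl ?row_mxEr [RHS]mxE.
Qed.

Lemma restr0 n (J : pred 'I_n) : restr J 0 = 0.
Proof. by apply/rowP => i; rewrite !mxE if_same. Qed.

(** The full direct sum is bounded factor by factor. Its even vectors form the glued lattice: they
    pair vectors of equal parity, so two nonzero vectors of equal parity cannot lie in the two
    factors of an even-free box. *)
Lemma good_sum m n (A : 'M[R]_m) X p (B : 'M[R]_n) Y q :
  good A X p -> good B Y q ->
  good (block_mx A 0 0 B) (col_mx X Y) (p * q).
Proof.
move=> [uA p0 fA eA [a [a0 fa pa]] lA] [uB q0 fB eB [b [b0 fb pb]] lB].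
have dAB : \det (block_mx A 0 0 B) = \det A * \det B by rewrite det_ublock.
have posl (c : 'rV[R]_(m + n)) : (forall i, 0 < c 0 i) -> forall i, 0 < lsubmx c 0 i.
  by move=> h i; rewrite mxE.
have posr (c : 'rV[R]_(m + n)) : (forall i, 0 < c 0 i) -> forall i, 0 < rsubmx c 0 i.
  by move=> h i; rewrite mxE.
have prod_ge0 k (c : 'rV[R]_k) : (forall i, 0 < c 0 i) -> 0 <= \prod_i c 0 i.
  by move=> h; apply: prodr_ge0 => i _; exact: ltW.
split.
- by rewrite unitmxE dAB unitrM -!unitmxE uA.
- exact: mulr_ge0.
- move=> c c0 fc; rewrite dAB normrM mulrACA -[c]hsubmxK prod_row.
  apply: ler_pM; rewrite ?prod_ge0//; try exact: posl; try exact: posr.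
  + apply: fA (posl _ c0) _ => d dc; suff: row_mx d (0 : 'rV_n) = 0.
      by rewrite -row_mx0 => /eq_row_mx[].
    apply: fc; rewrite pt_row pt0 -[c]hsubmxK; apply/in_box_row; split => //.
    exact/in_box0/posr.
  + apply: fB (posr _ c0) _ => d dc; suff: row_mx (0 : 'rV_m) d = 0.
      by rewrite -row_mx0 => /eq_row_mx[].
    apply: fc; rewrite pt_row pt0 -[c]hsubmxK; apply/in_box_row; split => //.
    exact/in_box0/posl.
- move=> c c0 fc; rewrite dAB normrM -[c]hsubmxK prod_row.
  have key d d' : in_box (lsubmx c) (pt A d) -> in_box (rsubmx c) (pt B d') ->
      even X d = even Y d' -> d = 0 /\ d' = 0.
    move=> h h' e; apply: (@eq_row_mx _ _ _ _ d d' 0 0); rewrite row_mx0.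
    apply: fc; first by rewrite even_row e.
    by rewrite pt_row -[c]hsubmxK; apply/in_box_row.
  (* Either the left factor is free and the right one even-free, or the left factor contains an odd
     vector [d]. In the latter case the left factor is still even-free, and the right one is free:
     an even vector pairs with 0 and an odd one with [d]. *)
  have [fl|] := pselect (free_box A (lsubmx c)).
    have /fA := fl => /(_ (posl _ c0)) h1.
    have h2 : \prod_i rsubmx c 0 i <= 2 * q * `|\det B|.
      apply: eB (posr _ c0) _ => d ed dc.
      have [] // := @key 0 d; rewrite ?even0 ?ed// pt0; exact/in_box0/posl.
    have := ler_pM (prod_ge0 _ _ (posl _ c0)) (prod_ge0 _ _ (posr _ c0)) h1 h2.
    by move=> /le_trans; apply; lra.
  move=> /existsNP[d /not_implyP[dc /eqP d0]].
  have od : ~~ even X d.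
    apply/negP => ed; have [] // := @key d 0; rewrite ?even0 ?ed// ?pt0//.
      exact/in_box0/posr.
    by move=> /eqP; rewrite (negPf d0).
  have h1 : \prod_i lsubmx c 0 i <= 2 * p * `|\det A|.
    apply: eA (posl _ c0) _ => d' ed dc'.
    have [] // := @key d' 0; rewrite ?even0 ?ed// pt0; exact/in_box0/posr.
  have h2 : \prod_i rsubmx c 0 i <= q * `|\det B|.
    apply: fB (posr _ c0) _ => d' dc'; case ed: (even Y d').
      have [] // := @key 0 d'; rewrite ?even0 ?ed// pt0; exact/in_box0/posl.
    by have [] // := @key d d'; rewrite ed (negPf od).
  have := ler_pM (prod_ge0 _ _ (posl _ c0)) (prod_ge0 _ _ (posr _ c0)) h1 h2.
  by move=> /le_trans; apply; lra.
- exists (row_mx a b); split.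
  + by move=> i; rewrite -(splitK i); case: (fintype.split i) => j /=;
      rewrite ?row_mxEl ?row_mxEr.
  + move=> c; rewrite -[c]hsubmxK pt_row => /in_box_row[/fa -> /fb ->].
    by rewrite row_mx0.
  + by rewrite prod_row pa pb dAB normrM mulrACA.
(* The linking vector of the block containing [l] is extended by zero; injectivity of [pt] makes
   [c'] vanish on the other block, so the parity is decided in one block. *)
- move=> l; rewrite -(splitK l); case: (fintype.split l) => j /=.
  + have [c oc hc] := lA j; exists (row_mx c 0).
      by rewrite even_row even0 eqb_id.
    move=> J c'; rewrite -[c']hsubmxK !pt_row restr_row pt0 restr0 => Jl.
    move=> /eq_row_mx[/hc hl]; rewrite -[RHS](pt0 B) => /(pt_inj uB) ->.
    by rewrite even_row even0 hl.
  + have [c oc hc] := lB j; exists (row_mx 0 c).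
      by rewrite even_row even0.
    move=> J c'; rewrite -[c']hsubmxK !pt_row restr_row pt0 restr0 => Jl.
    move=> /eq_row_mx[]; rewrite -[RHS](pt0 A) => /(pt_inj uA) -> /hc hr.
    by rewrite even_row even0 hr.
Qed.

(** * The trivial blocks: dimensions one and zero *)

Lemma good_int : good (1 : 'M[R]_1) (const_mx 1) 1.
Proof.
have ptE c : pt (1 : 'M[R]_1) c 0 0 = (c 0 0)%:~R.
  by rewrite /pt mulmx1 mxE.
have evE c : even (const_mx 1 : 'cV_1) c = (2 %| (c 0 0)%R)%Z.
  by rewrite /even mxE big_ord1 mxE mulr1.
have c0P (c : 'rV[int]_1) : c 0 0 = 0 -> c = 0.
  by move=> h; apply/rowP => i; rewrite ord1 h mxE.
split.
- exact: unitmx1.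
- exact: ler01.
- move=> a a0 fa; rewrite big_ord1 det1 normr1 mulr1 leNgt; apply/negP => a1.
  have /rowP/(_ 0) : const_mx 1 = 0 :> 'rV[int]_1.
    by apply: fa => i; rewrite (ord1 i) ptE mxE normr1.
  by rewrite !mxE.
- move=> a a0 fa; rewrite big_ord1 det1 normr1 !mulr1 leNgt; apply/negP => a1.
  have /rowP/(_ 0) : const_mx 2 = 0 :> 'rV[int]_1.
    by apply: fa => [|i]; rewrite ?evE ?(ord1 i) ?ptE mxE ?ger0_norm.
  by rewrite !mxE.
- exists (const_mx 1); split.
  + by move=> i; rewrite mxE.
  + move=> c /(_ 0); rewrite ptE mxE -intr_norm -[1]/(1%:~R) ltr_int => h.
    by apply: c0P; lia.
  + by rewrite big_ord1 mxE det1 normr1 mulr1.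
- move=> l; exists (const_mx 1); first by rewrite evE mxE.
  move=> J c'; rewrite (ord1 l) => J0 /rowP/(_ 0); rewrite ptE mxE (negPf J0).
  by move/eqP; rewrite intr_eq0 evE => /eqP ->.
Qed.

Lemma good_empty : good (1 : 'M[R]_0) 0 1.
Proof.
have e (c : 'rV[int]_0) : c = 0 by apply/rowP => -[].
split=> //; rewrite ?unitmx1 ?det1 ?normr1 ?mulr1//.
- by move=> a _ _; rewrite big_ord0.
- by move=> a _ _; rewrite big_ord0; lra.
- by exists 0; split; [case| |rewrite big_ord0].
- by case.
Qed.

(** * Quadratic lattices *)

Definition free_pair (a h s t : R) : Prop := forall x y : int,
  `|x%:~R + y%:~R * a| < s -> `|x%:~R - y%:~R * h| < t -> x = 0 /\ y = 0.

(** [a] and [- h] are the roots of [X^2 - 2 b X - 2], so the forms in [free_pair] are the conjugate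
    embeddings of [x + y a]. For [1 < s <= a] the element 1 forces [t <= 1]; for [a < s <= e] the
    element [a] forces [t <= h], and [e h = a]. Larger [s] reduces to these by the unit [e], and
    [s <= 1 < t] by conjugation. *)
Lemma free_pair_le (a h : R) (b : int) s t :
  0 < a -> a * h = 2 -> a - h = 2 * b%:~R -> 1 <= b -> 0 < s -> 0 < t ->
  free_pair a h s t -> s * t <= a.
Proof.
move=> a0 ah amh b1 s0 t0; set c : R := b%:~R in amh *.
have c1 : 1 <= c by rewrite -[1]/(1%:~R) ler_int.
have h0 : 0 < h by rewrite -(pmulr_rgt0 _ a0) ah.
have a2 : 2 <= a by lra.
have aE : a = h + 2 * c by lra.
have aa : a * a = 2 + 2 * c * a by rewrite {2}aE mulrDr ah; ring.
have hh : h * h = a * h - 2 * c * h by rewrite aE; ring.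
rewrite ah in hh.
(* [e = a ^ 2 / 2] is a unit with conjugate [e']: multiplication by [(e, e')]
   preserves the lattice, which brings [s] into the interval [1 < s <= e]. *)
pose e := 1 + c * a; pose e' := 1 - c * h.
have e2 : 2 <= e by rewrite /e; nra.
have e0 : 0 < e by lra.
have ee' : e * e' = 1 by rewrite /e /e'; nra.
have e'0 : 0 < e' by nra.
have eh : e * h = a by rewrite /e; nra.
have descent n : forall u v, 0 < v -> 1 < u -> u <= e ^+ n ->
    free_pair a h u v -> u * v <= a.
  elim: n => [|n IHn] u v v0 u1 un fr; first by lra.
  have [ua|ua] := leP u a.
    suff v1 : v <= 1 by nra.
    rewrite leNgt; apply/negP => v1.
    by have [] // := fr 1 0; rewrite ?mul0r ?addr0 ?subr0 normr1.
  have [ue|ue] := leP u e.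
    suff vh : v <= h by nra.
    rewrite leNgt; apply/negP => vh.
    by have [] // := fr 0 1; rewrite ?mul1r ?add0r ?sub0r ?normrN gtr0_norm.
  have -> : u * v = (u * e') * (v * e) by rewrite mulrACA [e' * e]mulrC ee' mulr1.
  have uE : u = u * e' * e by rewrite -mulrA [e' * e]mulrC ee' mulr1.
  have vE : v = v * e * e' by rewrite -mulrA ee' mulr1.
  apply: IHn; [nra|nra| |].
    by rewrite -(ler_pM2r e0) -uE -exprSr.
  move=> x y xu yv.
  have hu : `|(x%:~R + y%:~R * a) * e| < u.
    by rewrite uE normrM (gtr0_norm e0) ltr_pM2r.
  have hv : `|(x%:~R - y%:~R * h) * e'| < v.
    by rewrite vE normrM (gtr0_norm e'0) ltr_pM2r.
  (* The coordinates of [e (x + y a)], by [a^2 = 2 + 2 b a]. *)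
  have [] := fr (x + 2 * b * y) (y + b * (x + 2 * b * y)).
  - move: hu; congr (`|_| < _); rewrite !(intrD, intrM) -/c /e.
    have -> : (x%:~R + y%:~R * a) * (1 + c * a) =
      x%:~R + y%:~R * a + c * x%:~R * a + c * y%:~R * (a * a) by ring.
    by rewrite aa; ring.
  - move: hv; congr (`|_| < _); rewrite !(intrD, intrM) -/c /e'.
    have -> : (x%:~R - y%:~R * h) * (1 - c * h) =
      x%:~R - y%:~R * h - c * x%:~R * h + c * y%:~R * (h * h) by ring.
    by rewrite hh; ring.
  - by move=> h1; rewrite h1 mulr0 addr0 => h2; move: h1; rewrite h2 mulr0 addr0.
have large u v : 0 < v -> 1 < u -> free_pair a h u v -> u * v <= a.
  move=> v0 u1; apply: (@descent (Num.truncn u).+1) => //.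
  apply: ltW; apply: lt_le_trans (truncnS_gt u) _.
  apply: le_trans (_ : 2 ^+ (Num.truncn u).+1 <= _).
    by rewrite -natrX ler_nat ltnW// ltn_expl.
  by apply: lerXn2r; rewrite ?nnegrE; lra.
have [s1|s1] := ltP 1 s; first exact: large.
have [t1|t1] := ltP 1 t; last by nra.
move=> fr; rewrite mulrC; apply: large => // x y hx hy.
(* The coordinates of the conjugate [x - y h], since [h = a - 2 b]; conjugation swaps the two
   forms. *)
have [] := fr (x + 2 * b * y) (- y).
- by move: hy; congr (`|_| < _); rewrite !(intrD, intrM, intrN) -/c aE; ring.
- by move: hx; congr (`|_| < _); rewrite !(intrD, intrM, intrN) -/c aE; ring.
- by move=> + /eqP; rewrite oppr_eq0 => + /eqP y0; rewrite y0 mulr0 addr0.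
Qed.

Definition field_basis (a h : R) : 'M[R]_2 :=
  \matrix_(i, j) (if i == 0 then 1 else if j == 0 then a else - h).

Definition field_parity : 'cV[int]_2 := \col_i (i == 0)%:R.

Lemma pt_field a h c :
  (pt (field_basis a h) c 0 0 = (c 0 0)%:~R + (c 0 1)%:~R * a) *
  (pt (field_basis a h) c 0 1 = (c 0 0)%:~R - (c 0 1)%:~R * h).
Proof.
have l0 : lift ord0 ord0 = 1 :> 'I_2 by exact: val_inj.
have o0 : ord0 = 0 :> 'I_2 by exact: val_inj.
by split; rewrite mxE !big_ord_recl big_ord0 !mxE l0 o0 /= addr0 mulr1 ?mulrN.
Qed.

Lemma even_field c : even field_parity c = (2 %| (c 0 0)%R)%Z.
Proof.
by rewrite /even mxE !big_ord_recl big_ord0 !mxE /= mulr1 mulr0 !addr0.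
Qed.

Lemma forall_ord2 (P : 'I_2 -> Prop) : P 0 -> P 1 -> forall i, P i.
Proof.
by move=> P0 P1 [[|[|//]] i2]; [move: P0|move: P1]; congr P; exact: val_inj.
Qed.

Lemma row2P (T : pzRingType) (u v : 'rV[T]_2) : u 0 0 = v 0 0 -> u 0 1 = v 0 1 -> u = v.
Proof. by move=> e0 e1; apply/rowP; apply: forall_ord2. Qed.

Lemma good_field (a h : R) (b : int) :
  0 < a -> a * h = 2 -> a - h = 2 * b%:~R -> 1 <= b ->
  good (field_basis a h) field_parity (a / (a + h)).
Proof.
move=> a0 ah amh b1.
have h0 : 0 < h by rewrite -(pmulr_rgt0 _ a0) ah.
have a2 : 2 <= a.
  by have : 1 <= b%:~R :> R; [rewrite -[1]/(1%:~R) ler_int|lra].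
have dE : `|\det (field_basis a h)| = a + h.
  rewrite (expand_det_row _ 0) !big_ord_recl big_ord0 /cofactor !det_mx11 !mxE /=.
  by rewrite -[RHS]gtr0_norm ?addr_gt0// -normrN; congr `|_|; ring.
have qd : a / (a + h) * `|\det (field_basis a h)| = a.
  by rewrite dE divfK// lt0r_neq0// addr_gt0.
have prod2 (u : 'rV[R]_2) : \prod_i u 0 i = u 0 0 * u 0 1.
  rewrite !big_ord_recl big_ord0 mulr1.
  by congr (u 0 _ * u 0 _); exact: val_inj.
have freeP u : free_box (field_basis a h) u -> free_pair a h (u 0 0) (u 0 1).
  move=> fu x y hx hy; pose c : 'rV[int]_2 := \row_i (if i == 0 then x else y).
  have /rowP c0 : c = 0 by apply: fu; apply: forall_ord2; rewrite pt_field !mxE.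
  by have := c0 0; have := c0 1; rewrite !mxE.
split.
- by rewrite unitmxE unitfE -normr_gt0 dE addr_gt0.
- by rewrite divr_ge0 ?addr_ge0 ?ltW.
- move=> u u0 /freeP fu; rewrite qd prod2.
  exact: (free_pair_le a0 ah amh b1 (u0 _) (u0 _) fu).
- (* the even sublattice is the image of the whole lattice under
     multiplication by [(a, - h)] *)
  move=> u u0 fu; rewrite -mulrA qd prod2.
  have : free_pair a h (u 0 0 / a) (u 0 1 / h).
    move=> x y hx hy.
    (* The coordinates of [a (x + y a)]; the first is even. *)
    pose c : 'rV[int]_2 := \row_i (if i == 0 then 2 * y else x + 2 * b * y).
    have /rowP c0 : c = 0.
      apply: fu; first by rewrite even_field mxE dvdz_mulr.
      have E1 : (2 * y)%:~R = a * h * y%:~R :> R by rewrite ah intrM.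
      have E2 : (x + 2 * b * y)%:~R = x%:~R + (a - h) * y%:~R :> R.
        by rewrite amh intrD !intrM.
      apply: forall_ord2; rewrite pt_field !mxE /= E1 E2.
        move: hx; rewrite ltr_pdivlMr// -{2}(gtr0_norm a0) -normrM.
        by congr (`|_| < _); ring.
      move: hy; rewrite ltr_pdivlMr// -{2}(gtr0_norm h0) -normrM.
      by rewrite -normrN; congr (`|_| < _); ring.
    by have := c0 0; have := c0 1; rewrite !mxE /=; lia.
  move=> /(free_pair_le a0 ah amh b1) -/(_ (divr_gt0 (u0 _) a0) (divr_gt0 (u0 _) h0)).
  rewrite mulrACA -invfM ah ler_pdivrMr//; lra.
(* If [y] is nonzero, the side [a] forces [x] to be nonzero of the opposite sign, and then
   [|x - y h| >= 1 + h] exceeds the side 1. *)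
- exists (\row_i (if i == 0 then a else 1)); split.
  + by apply: forall_ord2; rewrite mxE.
  + move=> c hc; have := hc 1; have := hc 0; rewrite !pt_field !mxE /=.
    move: (c 0 0) (c 0 1) (@row2P _ c 0); rewrite !mxE => x y cP.
    rewrite !ltr_norml => /andP[h1 h2] /andP[h3 h4].
    suff [x0 y0] : x = 0 /\ y = 0 by exact: cP.
    have [yp|yn|y0] := ltrgtP y 0; clear cP hc.
    * have yR : y%:~R <= -1 :> R by rewrite -[-1]/((-1)%:~R) ler_int; lia.
      have yaR := ler_wpM2r (ltW a0) yR; have yhR := ler_wpM2r (ltW h0) yR.
      have xR : 0 < x%:~R :> R by lra.
      have : 1 <= x%:~R :> R by move: xR; rewrite -[1]/(1%:~R) ltr0z ler_int; lia.
      by move=> ?; exfalso; lra.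
    * have yR : 1 <= y%:~R :> R by rewrite -[1]/(1%:~R) ler_int; lia.
      have yaR := ler_wpM2r (ltW a0) yR; have yhR := ler_wpM2r (ltW h0) yR.
      have xR : x%:~R < 0 :> R by lra.
      have : x%:~R <= -1 :> R by move: xR; rewrite -[-1]/((-1)%:~R) ltrz0 ler_int; lia.
      by move=> ?; exfalso; lra.
    * split=> //; move: h3 h4; rewrite y0 mul0r subr0.
      by rewrite -[-1]/((-1)%:~R) -[1]/(1%:~R) !ltr_int; lia.
  + by rewrite qd prod2 !mxE /= mulr1.
- move=> l; exists (\row_i (i == 0)%:R); first by rewrite even_field mxE.
  move=> J c' Jl /rowP e; rewrite even_field.
  have := e 0; have := e 1; rewrite ![restr _ _ _ _]mxE !pt_field !mxE /=.
  rewrite !mul0r addr0 subr0 mulr1z.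
  move: (c' 0 0) (c' 0 1) => x y e1 e0.
  (* The linking vector is the element 1, embedded as [(1, 1)]. Coordinates of its restriction
     differ by at most 1, but those of [x + y a] differ by [y (a + h)] with [a + h > 1]. Then
     [x = 0] because the coordinate [l] is cut off. *)
  have y0 : y = 0.
    have h1 : y%:~R * (a + h) = (if J 0 then 1 else 0) - (if J 1 then 1 else 0).
      by rewrite -e0 -e1; ring.
    have ah0 : 0 <= a + h by lra.
    have [yp|yn|//] := ltrgtP y 0; exfalso.
    + have yR : y%:~R <= -1 :> R by rewrite -[-1]/((-1)%:~R) ler_int; lia.
      by have := ler_wpM2r ah0 yR; move: h1; do 2!case: ifP => _; lra.
    + have yR : 1 <= y%:~R :> R by rewrite -[1]/(1%:~R) ler_int; lia.
      by have := ler_wpM2r ah0 yR; move: h1; do 2!case: ifP => _; lra.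
  have x0 : x%:~R = 0 :> R.
    move: l Jl e0 e1; rewrite y0 mulr0z !mul0r addr0 subr0.
    by apply: forall_ord2 => /negPf -> // _.
  by move/eqP: x0; rewrite intr_eq0 => /eqP ->.
Qed.

(** * Gluing Z to a marked lattice *)

Definition glue_basis (n : nat) (B : 'M[R]_n) (X : 'cV[int]_n) : 'M[R]_(1 + n) :=
  block_mx 2%:M 0 (map_mx intr X) B.

Lemma det_glue n (B : 'M[R]_n) X : \det (glue_basis B X) = 2 * \det B.
Proof. by rewrite det_lblock det_scalar1. Qed.

Lemma glue_lattice_basis n (B : 'M[R]_n) X : B \in unitmx ->
  lattice_basis (int_span (glue_basis B X)) (glue_basis B X).
Proof.
by move=> uB; split=> //; rewrite unitmxE det_glue unitrM -unitmxE uB unitfE pnatr_eq0.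
Qed.

(** Each basis vector is lifted by its value under [X], and the extra row [(2, 0)] makes the first
    coordinate an arbitrary integer of the prescribed parity. *)
Lemma int_span_glue n (B : 'M[R]_n) X z :
  int_span (glue_basis B X) z <->
  exists k c, even X c = (2 %| k)%Z /\ z = row_mx (k%:~R)%:M (pt B c).
Proof.
have ptE (k : 'rV_1) c : map_mx intr (row_mx k c) *m glue_basis B X =
    row_mx ((k 0 0 * 2 + (c *m X) 0 0)%:~R)%:M (pt B c).
  rewrite map_row_mx mul_row_block mulmx0 add0r; congr row_mx.
  rewrite -map_mxM mul_mx_scalar; apply/rowP => i.
  by rewrite (ord1 i) !mxE mulr1n intrD intrM mulrC.
split=> [[d _ <-]|[k [c [ec ->]]]].
  rewrite -[d]hsubmxK ptE; eexists; eexists; split; last by [].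
  rewrite /even; lia.
(* Solves [2 d + c X = k] for [d]; the division is exact because the parities agree. *)
exists (row_mx ((k - ((c *m X) 0 0)%R) %/ 2)%Z%:M c) => //.
rewrite ptE mxE mulr1n divzK ?subrK//.
by move: ec; rewrite /even; lia.
Qed.

Lemma admissible_box n (L : set 'rV[R]_n) a :
  admissible L (box a) <-> forall z, L z -> in_box a z -> z = 0.
Proof. by split=> h z Lz az; apply: h => //; exact/interior_box. Qed.

Lemma glue_admissible n (B : 'M[R]_n) X s a : B \in unitmx ->
  admissible (int_span (glue_basis B X)) (box (row_mx s%:M a)) <->
  forall k c, even X c = (2 %| k)%Z -> `|k%:~R| < s -> in_box a (pt B c) ->
    k = 0 /\ c = 0.
Proof.
move=> uB; rewrite admissible_box; split=> [h k c e ks ca|h z].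
  have : row_mx (k%:~R)%:M (pt B c) = 0.
    apply: h; first by apply/int_span_glue; exists k, c.
    by apply/in_box_row; split=> // i; rewrite (ord1 i) !mxE.
  rewrite -row_mx0 => /eq_row_mx[/rowP/(_ 0)]; rewrite !mxE mulr1n => /eqP.
  by rewrite intr_eq0 -[X in _ = X](pt0 B) => /eqP -> /(pt_inj uB) ->.
move=> /int_span_glue[k [c [e ->]]] /in_box_row[/(_ 0)]; rewrite !mxE !mulr1n.
by move=> ks ca; have [] := h k c e ks ca => -> ->; rewrite pt0 raddf0 row_mx0.
Qed.

(** If [a] is free, [(2, 0)] forces [s <= 2]. Otherwise [a] contains an odd vector [c], the point
    [(1, c)] forces [s <= 1], and [a] is still even-free: both cases give the same bound. *)
Lemma glue_volume_le n (B : 'M[R]_n) X q s a : good B X q ->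
  (forall i, 0 < (row_mx s%:M a : 'rV_(1 + n)) 0 i) ->
  admissible (int_span (glue_basis B X)) (box (row_mx s%:M a)) ->
  s * \prod_i a 0 i <= 2 * q * `|\det B|.
Proof.
move=> g sa0 /glue_admissible-/(_ (good_unit g)) h.
have s0 : 0 < s by have := sa0 (lshift n 0); rewrite row_mxEl !mxE.
have a0 i : 0 < a 0 i by have := sa0 (rshift 1 i); rewrite row_mxEr.
have a_ge0 : 0 <= \prod_i a 0 i by apply: prodr_ge0 => i _; exact: ltW.
have [fa|] := pselect (free_box B a).
  have s2 : s <= 2.
    rewrite leNgt; apply/negP => s2; have [] // := h 2 0; rewrite ?even0//.
      by rewrite ger0_norm.
    by rewrite pt0; exact: in_box0.
  by rewrite -mulrA; apply: ler_pM => //; [exact: ltW|exact: good_free g _ a0 fa].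
move=> /existsNP[c /not_implyP[ca /eqP c0]].
have oc : ~~ even X c.
  apply/negP => ec; have [] // := h 0 c; rewrite ?ec ?normr0//.
  by move=> _ /eqP; rewrite (negPf c0).
have s1 : s <= 1.
  rewrite leNgt; apply/negP => s1; have [] // := h 1 c; rewrite ?(negPf oc)//.
  by rewrite normr1.
rewrite -[leRHS]mul1r; apply: ler_pM => //; first exact: ltW.
apply: (good_even_free g) => // d ed da.
by have [] // := h 0 d; rewrite ?ed ?normr0.
Qed.

Lemma box_vol_ratio n (a : 'rV[R]_n) v :
  box_vol a / (2 ^+ n * v) = (\prod_i a 0 i) / v.
Proof.
rewrite /box_vol big_split /= prodr_const card_ord invfM mulrACA divff ?mul1r// expf_neq0.
Qed.

Lemma kappa_glue n (B : 'M[R]_n) X q : good B X q ->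
  kappa (int_span (glue_basis B X)) = q.
Proof.
move=> g; have uB := good_unit g.
have dB : 0 < `|\det B| by rewrite normr_gt0 -unitfE -unitmxE.
have cE : covol (int_span (glue_basis B X)) = 2 * `|\det B|.
  by rewrite (covolE (glue_lattice_basis X uB)) det_glue normrM (@ger0_norm _ 2).
have [a [a0 fa pa]] := good_attained g.
rewrite /kappa cE; set E := [set _ | _ in _].
have qE : E q.
  (* The supremum is attained by adding the half-side 2 to an extremal free box: a lattice point
     inside has [c = 0], so its first coordinate is even and less than 2 in absolute value. *)
  exists (row_mx 2%:M a : 'rV_(1 + n)); first split.
  - move=> i; rewrite -(splitK i); case: (fintype.split i) => j /=.
      by rewrite row_mxEl (ord1 j) mxE.
    by rewrite row_mxEr.
  - apply/glue_admissible => // k c ek k2 /fa c0; split=> //.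
    move: ek k2; rewrite c0 even0 => ek.
    by rewrite -intr_norm -[2]/(2%:~R) ltr_int; lia.
  - rewrite box_vol_ratio prod_row big_ord1 mxE mulr1n pa mulrCA.
    by rewrite mulfK// mulf_neq0// lt0r_neq0.
have ubE : ubound E q.
  move=> _ [b [b0 hb] <-]; rewrite box_vol_ratio ler_pdivrMr ?mulr_gt0//.
  have bE : b = row_mx (b 0 (lshift n 0))%:M (rsubmx (b : 'rV_(1 + n))).
    rewrite -[LHS](@hsubmxK _ 1 1 n); congr row_mx; apply/rowP => i.
    by rewrite (ord1 i) !mxE.
  rewrite bE in b0 hb *; rewrite prod_row big_ord1 mxE mulr1n.
  by apply: le_trans (glue_volume_le g b0 hb) _; rewrite mulrCA mulrA.
apply/eqP; rewrite eq_le; apply/andP; split.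
  by apply: ge_sup => //; exists q.
by apply: ub_le_sup => //; exists q.
Qed.

(** A splitting makes the lattice stable under restriction to the side [J] of the glued coordinate.
    Restricting [(1, c)], with [c] the linking vector of a coordinate outside [J], keeps the odd
    first entry, while [good_linked] makes the rest even. *)
Lemma glue_indecomposable n (B : 'M[R]_n) X q : good B X q ->
  ~ decomposable (int_span (glue_basis B X)).
Proof.
move=> g [I [I0 CI0 LE]]; set L := int_span _ in LE.
suff key (J : pred 'I_(1 + n)) l : J (lshift n 0) -> ~~ J l ->
    (forall z, L z -> L (restr J z)) -> False.
  have Lr (J : {set 'I_(1 + n)}) : J = I \/ J = ~: I ->
      forall z, L z -> L (restr (fun i => i \in J) z).
    move=> IJ z; rewrite {1}LE => -[x [Lx xI] [y [Ly yI] <-]].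
    case: IJ => ->.
      suff -> : restr (fun i => i \in I) (x + y) = x by [].
      apply/rowP => i; rewrite !mxE; case: ifPn => [iI|/xI //].
      by rewrite yI ?addr0// inE iI.
    suff -> : restr (fun i => i \in ~: I) (x + y) = y by [].
    apply/rowP => i; rewrite !mxE; case: ifPn => [iI|/yI //].
    by rewrite xI ?add0r//; move: iI; rewrite !inE.
  have [iI|iI] := boolP (lshift n 0 \in I).
    have /card_gt0P[l lI] := CI0.
    by apply: (key (fun i => i \in I) l) => //; [move: lI; rewrite !inE|apply: Lr; left].
  have /card_gt0P[l lI] := I0.
  apply: (key (fun i => i \in ~: I) l); [|by rewrite !inE lI|by apply: Lr; right].
  by rewrite !inE.
move=> J0 Jl LJ; case: (split_ordP l) Jl => [i ->|i ->]; first by rewrite (ord1 i) J0.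
move=> Ji; have [c oc hc] := good_linked g i.
have /LJ : L (row_mx (1%:~R)%:M (pt B c)).
  by apply/int_span_glue; exists 1, c; rewrite (negPf oc).
rewrite restr_row => /int_span_glue[k [c' [e /eq_row_mx[]]]].
move=> /rowP/(_ 0); rewrite !mxE /= J0 !mulr1n => /intr_inj k1 /esym/hc.
by rewrite e -k1 => /(_ Ji).
Qed.

Lemma good_reduced_MG n (B : 'M[R]_n) X q : good B X q -> reduced_MG R (1 + n) q.
Proof.
move=> g; exists (int_span (glue_basis B X)); last exact: kappa_glue g.
split; last exact: glue_indecomposable g.
by exists (glue_basis B X); exact: glue_lattice_basis (good_unit g).
Qed.

(** * An increasing sequence of Mordell constants with limit 1 *)

Definition sqrt_disc (k : nat) : R := Num.sqrt (k.+1%:R ^+ 2 + 2).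

Definition alpha (k : nat) : R := sqrt_disc k + k.+1%:R.

(** Minus the conjugate of [alpha], that is, the [h] of [good_field] for [b = k + 1]. *)
Definition alphac (k : nat) : R := sqrt_disc k - k.+1%:R.

Definition field_kappa (k : nat) : R := alpha k / (alpha k + alphac k).

Lemma alpha_mul_conj k : alpha k * alphac k = 2.
Proof.
rewrite /alpha /alphac mulrC -subr_sqr sqr_sqrtr; first by rewrite addrC addKr.
by rewrite addr_ge0 ?sqr_ge0.
Qed.

Lemma alpha_sub_conj k : alpha k - alphac k = 2 * (k.+1%:Z)%:~R.
Proof. by rewrite /alpha /alphac -pmulrn; ring. Qed.

Lemma alpha_ge k : k.+1%:R <= alpha k.
Proof. by rewrite lerDr sqrtr_ge0. Qed.

Lemma alpha_gt0 k : 0 < alpha k.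
Proof. exact: lt_le_trans (ltr0Sn _ _) (alpha_ge k). Qed.

Lemma alphac_gt0 k : 0 < alphac k.
Proof. by rewrite -(pmulr_rgt0 _ (alpha_gt0 k)) alpha_mul_conj. Qed.

Lemma alphacE k : alphac k = 2 / alpha k.
Proof. by rewrite -(alpha_mul_conj k) mulrAC divff ?mul1r// gt_eqF ?alpha_gt0. Qed.

Lemma alpha_lt k : alpha k < alpha k.+1.
Proof.
rewrite ltr_leD//; last by rewrite ler_nat.
rewrite ltr_sqrt; last by rewrite ltr_wpDl ?sqr_ge0.
by rewrite ltrD2r ltr_pXn2r ?nnegrE// ltr_nat.
Qed.

(** [alpha] increases and [alphac = 2 / alpha] decreases, so [1 / (1 + alphac / alpha)]
    increases. *)
Lemma field_kappa_lt k : field_kappa k < field_kappa k.+1.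
Proof.
have := alpha_lt k; have := alpha_gt0 k; have := alpha_gt0 k.+1.
have := alphac_gt0 k; have := alphac_gt0 k.+1.
have : alphac k.+1 < alphac k.
  by rewrite !alphacE ltr_pM2l// ltf_pV2 ?posrE ?alpha_gt0 ?alpha_lt.
rewrite /field_kappa; move: (alpha k) (alpha k.+1) (alphac k) (alphac k.+1).
move=> a a' h h' hh h'0 h0 a'0 a0 aa.
by rewrite ltr_pdivrMr ?addr_gt0// mulrAC ltr_pdivlMr ?addr_gt0//; nra.
Qed.

Lemma field_kappa_gt0 k : 0 < field_kappa k.
Proof.
by apply: divr_gt0; first exact: alpha_gt0; apply: addr_gt0;
  [exact: alpha_gt0|exact: alphac_gt0].
Qed.

Lemma cvg_field_kappa : field_kappa @ \oo --> (1 : R).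
Proof.
(* [harmonic k] is [1 / (k + 1)]. The defect from 1 is [h / (a + h)], with [h <= 2] and
   [a >= k + 1]. *)
apply: (@squeeze_cvgr _ _ _ _ (fun k => 1 - 2 * harmonic k) (cst 1)).
- near=> k; have a0 := alpha_gt0 k; have h0 := alphac_gt0 k.
  have ah0 : 0 < alpha k + alphac k by exact: addr_gt0.
  have : alpha k * alphac k = 2 := alpha_mul_conj k.
  have : 1 <= harmonic k * alpha k.
    by rewrite /harmonic mulrC ler_pdivlMr// mul1r alpha_ge.
  have : 0 < harmonic k :> R by exact: harmonic_gt0.
  have : 1 <= alpha k by apply: le_trans (alpha_ge k); rewrite ler1n.
  rewrite /field_kappa; move: (alpha k) (alphac k) (harmonic k) a0 h0 ah0.
  move=> a h e a0 h0 ah0 a1 e0 ea ah; apply/andP; split.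
    by rewrite ler_pdivlMr//; nra.
  by rewrite /= ler_pdivrMr// mul1r lerDl ltW.
- rewrite -[X in _ --> X]subr0 -(mulr0 2); apply: cvgB; first exact: cvg_cst.
  by apply: cvgM; [exact: cvg_cst|exact: cvg_harmonic].
- exact: cvg_cst.
Unshelve. all: end_near. Qed.

(** * Products of constants and iterated left derivation *)

Lemma exists_good t (s : seq nat) : (size s <= t)%N ->
  exists (B : 'M[R]_(t.*2)) X, good B X (\prod_(k <- s) field_kappa k).
Proof.
elim: t s => [|t IHt] [|k s] //= st.
- by exists 1, 0; rewrite big_nil; exact: good_empty.
(* Two copies of Z, of constant 1, replace a missing quadratic block, so that the dimension depends
   on [t] alone. *)
- have [B [X g]] := IHt [::] isT.
  have := good_sum good_int (good_sum good_int g).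
  by rewrite !mul1r => g'; eexists; eexists; exact: g'.
- have [B [X g]] := IHt s st; rewrite big_cons.
  have gk := good_field (alpha_gt0 k) (alpha_mul_conj k) (alpha_sub_conj k) isT.
  by eexists; eexists; exact: good_sum gk g.
Qed.

(** Each derivation spends one free block: with one more factor [field_kappa k], the products
    increase to the product over [s] as [k] grows. *)
Lemma iter_left_derived_prod t j (s : seq nat) : (size s + j <= t)%N ->
  iter_left_derived j (reduced_MG R (1 + t.*2)) (\prod_(k <- s) field_kappa k).
Proof.
elim: j s => [|j IHj] s st.
  rewrite addn0 in st; have [B [X g]] := exists_good st.
  exact: good_reduced_MG g.
split; first by apply: IHj; lia.
exists (fun k => \prod_(i <- k :: s) field_kappa i); split.
- by move=> k; apply: IHj => /=; lia.
- apply/increasing_seqP => k; rewrite !big_cons ltr_pM2r ?field_kappa_lt//.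
  by rewrite prodr_gt0// => i _; exact: field_kappa_gt0.
- rewrite -[X in _ --> X]mul1r; under eq_fun do rewrite big_cons.
  by apply: cvgM; [exact: cvg_field_kappa|exact: cvg_cst].
Qed.

End MarkedLattice.

Theorem theorem1p16 (R : realType) (t : nat) :
  exists n : nat, (0 < n)%N /\ iter_left_derived t (reduced_MG R n) 1.
Proof.
exists (1 + t.*2)%N; split=> //.
by have := @iter_left_derived_prod R t t [::] (leqnn t); rewrite big_nil.
Qed.
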